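(* Let $h\ge 1$ be an integer, let $\varphi(x_1,\ldots,x_h)=\sum_{i=1}^h c_i x_i$ be a linear form with integer coefficients $c_1,\ldots,c_h$ that satisfies condition $N$, and let $B=\{b_1<b_2<\cdots\}$ be an infinite set of integers. Let $\epsilon>0$ be a real number. If $|b_t-b_s|\le (t-s+1)^{h-\epsilon}$ for all positive integers $t>s$, then there does not exist a $\varphi$-Sidon set of integers that is a bounded perturbation of $B$.
   Context: Condition $N$: for $I\subseteq\{1,\ldots,h\}$ put $s_I=\sum_{i\in I}c_i$, with $s_\emptyset=0$. The linear form $\varphi=\sum_{i=1}^h c_ix_i$ satisfies condition $N$ if there do not exist disjoint subsets $I_1,I_2$ of $\{1,\ldots,h\}$, not both empty, with $s_{I_1}=s_{I_2}$. $\varphi$-Sidon set: a nonempty set $A$ of integers is a $\varphi$-Sidon set if for all $h$-tuples $(a_1,\ldots,a_h)\in A^h$ and $(a_1',\ldots,a_h')\in A^h$, $\varphi(a_1,\ldots,a_h)=\varphi(a_1',\ldots,a_h')$ implies $(a_1,\ldots,a_h)=(a_1',\ldots,a_h')$. Bounded perturbation: a set of integers $A=\{a_k : k=1,2,3,\ldots\}$ (enumerated by pairwise distinct elements, in no particular order) is a bounded perturbation of $B=\{b_k : k=1,2,3,\ldots\}$ if there exist a real number $m_0>0$ and a positive integer $k_0$ such that $|a_k-b_k|<m_0$ for all integers $k\ge k_0$. *)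

(* Defs.v *)
From HB Require Import structures.
From mathcomp Require Import all_boot all_order all_algebra.

Set Implicit Arguments.
Unset Strict Implicit.
Unset Printing Implicit Defensive.

Import Order.TTheory GRing.Theory Num.Theory.

Local Open Scope ring_scope.

Definition linear_form (h : nat) (c : 'I_h -> int) (x : h.-tuple int) : int :=
  \sum_(i < h) c i * tnth x i.

Definition subset_sum (h : nat) (c : 'I_h -> int) (I : {set 'I_h}) : int :=
  \sum_(i in I) c i.

Definition condition_N (h : nat) (c : 'I_h -> int) : Prop :=
  ~ exists I1 I2 : {set 'I_h},
      [/\ [disjoint I1 & I2],
          ~ (I1 = set0 /\ I2 = set0) &
          subset_sum c I1 = subset_sum c I2].

(* Imported only here: these libraries shadow [set0] and [[disjoint _ & _]] of
   finite sets, used above. *)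
From mathcomp Require Import all_classical all_reals all_analysis.
Local Open Scope classical_set_scope.
Local Open Scope ring_scope.

Definition Sidon_set (h : nat) (c : 'I_h -> int) (A : set int) : Prop :=
  A !=set0 /\
  forall a a' : h.-tuple int,
    (forall i, A (tnth a i)) -> (forall i, A (tnth a' i)) ->
    linear_form c a = linear_form c a' -> a = a'.

(* Sequences are indexed by the positive integers; the value at 0 is never
   used. *)
Definition positive_index : set nat := [set k | (0 < k)%N].

Definition enumerates (a : nat -> int) (A : set int) : Prop :=
  set_inj positive_index a /\ a @` positive_index = A.

(* The perturbed set {b_k} is given through its enumeration b, since the condition
   compares a_k with b_k; A is a bare set, and its elements may be listed in
   any order. *)
Definition bounded_perturbation (R : realType) (A : set int) (b : nat -> int)
    : Prop :=
  exists2 a : nat -> int, enumerates a A &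
  exists (m0 : R) (k0 : nat),
    [/\ 0 < m0, (0 < k0)%N &
        forall k : nat, (k0 <= k)%N -> `|a k - b k|%:~R < m0].

(* Main.v *)
(* Pigeonhole. The n consecutive elements a_{k0}, ..., a_{k0+n-1} all lie within
   m0 + n^e of b_{k0}, where e = max(h - eps, 0) < h. If A were a Sidon set, the
   n^h tuples of such elements would give n^h distinct integer values of the form,
   all inside an interval of length O(n^e), which is impossible for large n. *)
Require Import Defs.
From mathcomp Require Import all_boot all_order all_algebra.
From mathcomp Require Import all_classical all_reals all_analysis.
From mathcomp Require Import zify lra.

Set Implicit Arguments.
Unset Strict Implicit.
Unset Printing Implicit Defensive.

Import Order.TTheory GRing.Theory Num.Theory.

Local Open Scope classical_set_scope.
Local Open Scope ring_scope.

Lemma linear_form_dist_le (h : nat) (c : 'I_h -> int) (beta : int) (M : nat)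
    (x : h.-tuple int) :
  (forall i, `|tnth x i - beta| <= M%:Z) ->
  `|linear_form c x - linear_form c (nseq_tuple h beta)|
     <= ((\sum_(i < h) `|c i|%N) * M)%N%:Z.
Proof.
move=> xM; rewrite /linear_form -sumrB big_distrl /= -natz natr_sum.
apply: le_trans (ler_norm_sum _ _ _) _; apply: ler_sum => i _.
rewrite tnth_nseq -mulrBr normrM natz PoszM abszE.
exact: ler_wpM2l.
Qed.

(** The values of the form are integers within [B] of its value at the constant tuple [beta], so at
    most [2 * B + 1] of them are distinct. *)
Lemma separated_tuples_bound (h n M : nat) (c : 'I_h -> int) (beta : int)
    (u : 'I_n -> int) :
  (forall j, `|u j - beta| <= M%:Z) ->
  injective (fun f : {ffun 'I_h -> 'I_n} =>
               linear_form c [tuple u (f i) | i < h]) ->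
  (n ^ h <= (2 * ((\sum_(i < h) `|c i|) * M)).+1)%N.
Proof.
move=> uM inj; set B := (_ * M)%N.
pose v (f : {ffun 'I_h -> 'I_n}) := linear_form c [tuple u (f i) | i < h].
pose w := linear_form c (nseq_tuple h beta).
have vw f : `|v f - w| <= B%:Z.
  by apply: linear_form_dist_le => i; rewrite tnth_mktuple.
(* Adding [B] makes the offset lie between 0 and [2 * B], so neither the absolute value nor [inord]
   loses information. *)
pose g f : 'I_(2 * B).+1 := inord `|(v f - w + B%:Z)%R|%N.
have g_inj : injective g.
  move=> f1 f2 /(congr1 val) /=.
  have := vw f1; have := vw f2 => v2 v1.
  rewrite !inordK; try lia.
  by move=> e; apply: inj; rewrite -/(v f1) -/(v f2); lia.
by have := leq_card g g_inj; rewrite card_ffun !card_ord.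
Qed.

Lemma powR_unbounded (R : realType) (K d : R) :
  0 < d -> 0 <= K -> exists2 n : nat, (0 < n)%N & K < n%:R `^ d.
Proof.
move=> d0 K0; exists (Num.truncn (K `^ d^-1)).+1 => //.
have lt : K `^ d^-1 < (Num.truncn (K `^ d^-1)).+1%:R :> R by apply: truncnS_gt.
have {1}-> : K = (K `^ d^-1) `^ d by rewrite -powRrM mulVf ?gt_eqF// powRr1.
by apply: gt0_ltr_powR => //; rewrite nnegrE ?powR_ge0.
Qed.

(** The Sidon property recovers the tuple of elements from the value, and injectivity of the
    enumeration then recovers the indices, all positive since [0 < s]. *)
Lemma Sidon_enum_inj (h n s : nat) (c : 'I_h -> int) (A : set int)
    (a : nat -> int) :
  Sidon_set c A -> enumerates a A -> (0 < s)%N ->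
  injective (fun f : {ffun 'I_h -> 'I_n} =>
               linear_form c [tuple a (s + f i)%N | i < h]).
Proof.
move=> [_ sidon] [a_inj aA] s0 f1 f2 eqf.
have pos k : positive_index (s + k)%N by rewrite /positive_index /=; lia.
have inA k : A (a (s + k)%N) by rewrite -aA; exists (s + k)%N.
have /(congr1 (fun t => tnth t _)) eqt :
    [tuple a (s + f1 i)%N | i < h] = [tuple a (s + f2 i)%N | i < h].
  by apply: sidon => // i; rewrite tnth_mktuple.
apply/ffunP => i; apply/val_inj/(@addnI s)/a_inj; rewrite ?inE //.
by have := eqt i; rewrite !tnth_mktuple.
Qed.

Theorem theorem1p2 (R : realType) (h : nat) (c : 'I_h -> int)
    (b : nat -> int) (eps : R)
    (h_ge1 : (1 <= h)%N)
    (hN : condition_N c)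
    (b_incr : forall s t : nat, (0 < s)%N -> (s < t)%N -> b s < b t)
    (eps_gt0 : 0 < eps)
    (b_growth : forall s t : nat, (0 < s)%N -> (s < t)%N ->
       `|b t - b s|%:~R <= (t - s + 1)%N%:R `^ (h%:R - eps) :> R) :
  ~ exists A : set int, Sidon_set c A /\ bounded_perturbation R A b.
Proof.
move=> [A [sidon [a enum [m0 [s [m0_gt0 s_gt0 ab]]]]]].
(* For [eps > h] the exponent [h - eps] is negative; cutting it off at 0 makes powers with exponent
   [e] monotone in the base, and [e < h] still holds because [h >= 1]. *)
pose e : R := Num.max (h%:R - eps) 0.
have e_ge0 : 0 <= e by rewrite le_max lexx orbT.
have e_lt_h : 0 < h%:R - e.
  by rewrite subr_gt0 gt_max ltrBlDr ltrDl eps_gt0 ltr0n.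
pose C := (\sum_(i < h) `|c i|)%N.
(* Chosen so that [2 * C * (m0 + n^e) + 1 <= K * n^e] as soon as [n^e >= 1]. *)
pose K : R := 2 * (C%:R * (m0 + 1)) + 1.
have K_ge0 : 0 <= K by rewrite !(addr_ge0, mulr_ge0)// ltW.
have [n n_gt0 Kn] := powR_unbounded e_lt_h K_ge0.
have n_ge1 : 1 <= n%:R :> R by rewrite ler1n.
have ne_ge1 : 1 <= n%:R `^ e :> R by rewrite -[leLHS](powRr0 n%:R) ler_powR.
pose M := Num.truncn (m0 + n%:R `^ e).
have M_le : M%:R <= m0 + n%:R `^ e.
  by rewrite truncn_le addr_ge0 ?powR_ge0 // ltW.
have near_bs (j : 'I_n) : `|a (s + j)%N - b s| <= M%:Z.
  have bb : `|b (s + j)%N - b s|%:~R <= n%:R `^ e :> R.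
    case: (posnP j) => [->|j_gt0]; first by rewrite addn0 subrr powR_ge0.
    apply: le_trans (b_growth _ _ s_gt0 _) _; first lia.
    (* The growth bound has base [j + 1], which is at most [n] because [j < n]. *)
    have -> : (s + j - s + 1 = j.+1)%N by lia.
    apply: (@le_trans _ _ (j.+1%:R `^ e)).
      by apply: ler_powR; rewrite ?ler1n// le_max lexx.
    by apply: ge0_ler_powR; rewrite ?nnegrE// ler_nat.
  have tri : `|a (s + j)%N - b s|%:~R <= m0 + n%:R `^ e :> R.
    apply: le_trans (lerD (ltW (ab (s + j)%N (leq_addr _ _))) bb).
    by rewrite -intrD ler_int; lia.
  (* The distance is an integer, so the real bound may be truncated to [M]. *)
  by rewrite -abszE lez_nat truncn_ge_nat ?addr_ge0// ltW.
have := separated_tuples_bound near_bs (Sidon_enum_inj sidon enum s_gt0).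
rewrite -/C -(ler_nat R) natrX -powR_mulrn; last by rewrite ler0n.
(* Splitting off [n^e] leaves the factor [n^(h - e)], which exceeds [K] by the choice of [n]. *)
have -> : h%:R = (h%:R - e) + e by rewrite subrK.
rewrite powRD; last by rewrite pnatr_eq0 -lt0n n_gt0 implybT.
apply/negP; rewrite -ltNge.
apply: (@le_lt_trans _ _ (K * n%:R `^ e)); last first.
  by rewrite ltr_pM2r //; apply: lt_le_trans ne_ge1.
have CM : C%:R * M%:R <= C%:R * (m0 + n%:R `^ e) :> R by exact: ler_wpM2l.
have Cm : C%:R * m0 <= C%:R * m0 * n%:R `^ e.
  by rewrite ler_peMr // mulr_ge0 // ltW.
rewrite -natr1 !natrM /K; lra.
Qed.
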